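(* For any $0 < c \le 1$, there exists a randomized algorithm that outputs a set of $2k+1$ elements such that, with probability at least $1 - O(k^{-c}\log k)$, the output set contains the uncorrupted maximum and the algorithm uses at most $O(n + k^{1+3c}\log k)$ comparison queries.
   Context: Model: there are $n > 2k+1$ elements $x_1,\dots,x_n$, exactly $k$ of which are corrupted (unknown to the algorithm). For every pair of distinct elements the comparison graph (a tournament) specifies which one is larger. The comparison graph restricted to the $n-k$ uncorrupted elements is acyclic; comparisons involving corrupted elements may be oriented arbitrarily. The uncorrupted maximum is the uncorrupted element larger than every other uncorrupted element. An algorithm knows $n$ and $k$, may query the orientation of any pair (a comparison query), and outputs a set of elements. $\log$ denotes the natural logarithm; asymptotics are as $k \to \infty$. *)

(* Defs.v *)
From Stdlib Require Import Reals ClassicalEpsilon.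
From Stdlib Require List.
From mathcomp Require Import all_boot.
Set Implicit Arguments. Unset Strict Implicit. Unset Printing Implicit Defensive.

(* Elements are x_0 .. x_{n-1}, indexed by 'I_n.
   A comparison graph is T : 'I_n -> 'I_n -> bool, T i j = "x_i is larger than x_j". *)

Definition tournament n (T : 'I_n -> 'I_n -> bool) : Prop :=
  forall i j : 'I_n, i != j -> T i j = ~~ T j i.

Definition edge n (T : 'I_n -> 'I_n -> bool) : rel 'I_n :=
  fun i j => (i != j) && T i j.

Definition acyclic_on n (T : 'I_n -> 'I_n -> bool) (U : {set 'I_n}) : Prop :=
  forall (x : 'I_n) (s : seq 'I_n),
    all (fun y => y \in U) (x :: s) -> ~~ cycle (edge T) (x :: s).

(* A valid instance: T a tournament, K the set of exactly k corrupted elements,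
   and the graph restricted to the uncorrupted elements is acyclic. *)
Definition valid_instance n (k : nat) (T : 'I_n -> 'I_n -> bool) (K : {set 'I_n}) : Prop :=
  tournament T /\ #|K| = k /\ acyclic_on T (~: K).

Definition uncorrupted_max n (T : 'I_n -> 'I_n -> bool) (K : {set 'I_n}) (u : 'I_n) : Prop :=
  u \in ~: K /\ forall v, v \in ~: K -> v != u -> edge T u v.

(* Deterministic adaptive comparison-query algorithm (decision tree). *)
Inductive dtree (n : nat) : Type :=
| DLeaf : {set 'I_n} -> dtree n
| DQuery : 'I_n -> 'I_n -> (bool -> dtree n) -> dtree n.
Arguments DLeaf {n}.
Arguments DQuery {n}.

Fixpoint run n (T : 'I_n -> 'I_n -> bool) (t : dtree n) : {set 'I_n} * nat :=
  match t with
  | DLeaf X => (X, 0)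
  | DQuery i j f => let r := run T (f (T i j)) in (r.1, r.2.+1)
  end.

Fixpoint leaves_size n (m : nat) (t : dtree n) : Prop :=
  match t with
  | DLeaf X => #|X| = m
  | DQuery _ _ f => forall b, leaves_size m (f b)
  end.

Open Scope R_scope.

(* A randomized algorithm = a finitely supported probability distribution over
   deterministic decision trees (weights, trees). *)
Definition randalg n := list (R * dtree n).

Definition total_weight n (A : randalg n) : R :=
  List.fold_right (fun p acc => fst p + acc) 0 A.

Definition valid_randalg n (m : nat) (A : randalg n) : Prop :=
  (forall w t, List.In (w, t) A -> 0 <= w /\ leaves_size m t) /\ total_weight A = 1.

Definition indicator (P : Prop) : R :=
  if excluded_middle_informative P then 1 else 0.

Definition prob n (A : randalg n) (T : 'I_n -> 'I_n -> bool)
  (E : {set 'I_n} * nat -> Prop) : R :=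
  List.fold_right (fun p acc => fst p * indicator (E (run T (snd p))) + acc) 0 A.

(* Main.v *)
Require Import Defs.
From Stdlib Require Import Reals ZArith Lra.
From mathcomp Require Import all_boot all_order all_algebra.
From mathcomp Require Import Rstruct zify ring lra.
Set Implicit Arguments. Unset Strict Implicit. Unset Printing Implicit Defensive.
Local Open Scope nat_scope.

(**
  Write [kap] for [k^c] and [lam] for [log k], rounded up.  The uncorrupted maximum [u] loses to
  at most [k] elements, and in any tournament at most [2l + 1] elements have at most [l] losses.

  - If [n > 8 k kap], draw [n lam / (k kap)] random elements and take their running maximum [p].
    With probability [1 - O(lam / kap)] no drawn element is corrupted while one of them lies among
    the top [4 k kap] uncorrupted elements; then [u] survives in [{p}] together with the elements
    above [p], a set of size [O(k kap)].
  - Sifting a set [X] compares every element of [X] with a random sample of [X] and keeps those whose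
    sampled losses do not exceed [(1 + 2d) k] after scaling.  By Chernoff and a union bound, [u]
    survives and at most [2 (1 + 6d) k + 1] elements do.  Sifting with [d = 1/4] leaves at most
    [6 k] elements, and sifting again with [d = 1 / (4 kap)] leaves [2 k + 1 + O(k / kap)].
  - Dropping the excess at random loses [u] with probability [O(1 / kap)].

  The number of queries is [O(n + k kap^2 lam)], below the required bound.
*)

(** * Losses in tournaments, and the order on an acyclic set *)

Section Tournament.
Variables (n : nat) (T : 'I_n -> 'I_n -> bool).
Hypothesis tT : tournament T.

Definition losses (X : {set 'I_n}) (x : 'I_n) : nat := #|[set y in X | edge T y x]|.

Lemma edge_total x y : x != y -> edge T x y (+) edge T y x.
Proof.
move=> nxy; rewrite /edge nxy eq_sym nxy /= (tT nxy); by case: (T y x).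
Qed.

Lemma edgeN x y : edge T x y -> ~~ edge T y x.
Proof.
move=> exy; have /edge_total : x != y by case/andP: exy.
by rewrite exy.
Qed.

(** Double counting: every pair of distinct elements of [X] produces exactly one loss. Adding the
    sum to its transpose avoids halving. *)
Lemma sum_losses (X : {set 'I_n}) :
  (\sum_(x in X) losses X x).*2 = #|X| * #|X|.-1.
Proof.
have E : forall x, losses X x = \sum_(y in X) edge T y x.
  move=> x; rewrite /losses -sum1_card big_mkcond [RHS]big_mkcond /=.
  by apply: eq_bigr => y _; rewrite inE; case: (y \in X); case: (edge T y x).
rewrite -addnn (eq_bigr _ (fun x _ => E x)) {2}exchange_big /= -big_split /=.
rewrite (eq_bigr (fun=> #|X|.-1)); first by rewrite sum_nat_const.
move=> x xX; rewrite -big_split /= (bigD1 x) //= /edge eqxx /= add0n.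
rewrite (eq_bigr (fun=> 1)) => [|y /andP[_ nyx]].
  by rewrite sum1_card (cardD1 x X) xX add1n /=; apply: eq_card => y; rewrite !inE andbC.
by have := edge_total nyx; rewrite /edge; do 2!case: (_ && _).
Qed.

(** Losses inside [Z] are at most losses inside [X], and inside [Z] they average
    [(#|Z| - 1) / 2]. *)
Lemma card_le_losses (X Z : {set 'I_n}) (l : nat) :
  Z \subset X -> (forall x, x \in Z -> losses X x <= l) -> #|Z| <= l.*2.+1.
Proof.
move=> sZX hl.
have := sum_losses Z; have : \sum_(x in Z) losses Z x <= \sum_(x in Z) l.
  apply: leq_sum => x xZ; apply: leq_trans (hl x xZ); apply: subset_leq_card.
  by apply/subsetP => y; rewrite !inE => /andP[/(subsetP sZX) -> ->].
rewrite sum_nat_const; case: #|Z| => // m; nia.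
Qed.

Variable U : {set 'I_n}.
Hypothesis acU : acyclic_on T U.

(** The opposite orientation of the pair [x], [z] would close a 3-cycle. *)
Lemma edge_trans_on x y z : x \in U -> y \in U -> z \in U ->
  edge T x y -> edge T y z -> edge T x z.
Proof.
move=> xU yU zU exy eyz.
have nxz : x != z by apply: contraTneq eyz => <-; apply: edgeN.
have := edge_total nxz; case: (edge T x z) => //= ezx.
have := @acU x [:: y; z]; rewrite /= xU yU zU exy eyz ezx.
by move=> /(_ isT).
Qed.

(** An element with fewest losses wins: if [v] beat it, transitivity would make the elements beating
    [v] a proper subset of those beating it. *)
Lemma exists_max_on (V : {set 'I_n}) : V \subset U -> V != set0 ->
  exists2 u, u \in V & forall v, v \in V -> v != u -> edge T u v.
Proof.
move=> sVU /set0Pn[x0 x0V].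
case: (@arg_minnP _ x0 (fun x => x \in V) (losses V) x0V) => u uV min_u.
exists u => // v vV nvu.
have := edge_total nvu; case euv : (edge T u v) => // /[!addbF] evu.
have : losses V v < losses V u; last by rewrite ltnNge min_u.
apply: proper_card; apply/properP; split.
  apply/subsetP => y; rewrite !inE => /andP[yV eyv]; rewrite yV /=.
  by apply: (@edge_trans_on _ v) => //; apply: (subsetP sVU).
by exists v; rewrite !inE ?vV ?evu // /edge eqxx andbF.
Qed.

(** Maxima are peeled off [U] one at a time. *)
Lemma exists_top_set t : t <= #|U| -> exists W : {set 'I_n},
  [/\ W \subset U, #|W| = t & forall x y, x \in W -> y \in U -> edge T y x -> y \in W].
Proof.
elim: t => [|t IH] tU; first by exists set0; rewrite sub0set cards0; split=> // x y; rewrite inE.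
have [W [sWU cW clW]] := IH (ltnW tU).
have [||u] := @exists_max_on (U :\: W); first exact: subsetDl.
  by rewrite -card_gt0 cardsD (setIidPr sWU) cW subn_gt0.
rewrite inE => /andP[uW uU] umax; exists (u |: W); split.
- by rewrite subUset sub1set uU.
- by rewrite cardsU1 uW cW.
move=> x y; rewrite !inE => /orP[/eqP->|xW] yU eyx; last by rewrite (clW x) ?orbT.
case: eqP => //= /eqP nyu; apply: contraTT eyx => yW; apply: edgeN.
by apply: umax => //; rewrite inE yW.
Qed.

Definition champion (p : 'I_n) (l : seq 'I_n) : 'I_n :=
  foldl (fun p y => if T y p then y else p) p l.

Lemma championP p l : p \in U -> {subset l <= U} ->
  champion p l \in U /\ forall y, y \in p :: l -> y = champion p l \/ edge T (champion p l) y.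
Proof.
elim: l p => [|z l IH] p pU lU /=.
  by split=> // y; rewrite inE => /eqP->; left.
have zU : z \in U by apply: lU; rewrite mem_head.
have [||cU cP] := IH (if T z p then z else p); first by case: ifP.
  by move=> y yl; apply: lU; rewrite inE yl orbT.
split=> // y; set q := champion _ _ in cU cP *.
have step a b : a \in U -> b \in U -> a = q \/ edge T q a -> b = a \/ edge T a b ->
    b = q \/ edge T q b.
  move=> aU bU [->|eqa] [->|eab]; [by left|by right|by right|right].
  exact: (@edge_trans_on q a).
have top := cP _ (mem_head _ _).
(* A tournament leaves the diagonal of [T] unconstrained, and samples repeat elements, so comparing
   an element with itself is treated apart: both answers keep [p]. *)
have [zp|nzp] := eqVneq z p.
  have topp : p = q \/ edge T q p by move: top; rewrite zp if_same.
  rewrite !inE zp => /or3P[/eqP->|/eqP->|yl] //; by apply: cP; rewrite inE yl orbT.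
have qU : (if T z p then z else p) \in U by case: ifP.
have Tzp : edge T z p = T z p by rewrite /edge nzp.
have Tpz : edge T p z = ~~ T z p by rewrite /edge eq_sym nzp /= (tT nzp) negbK.
rewrite !inE => /or3P[/eqP->|/eqP->|yl]; last by apply: cP; rewrite inE yl orbT.
  by apply: (step _ _ qU _ top) => //; case: ifP => // h; [right; rewrite Tzp|left].
by apply: (step _ _ qU _ top) => //; case: ifP => // h; [left|right; rewrite Tpz h].
Qed.

End Tournament.

(** * Query programs *)

Section Programs.
Variable n : nat.

(* Continuation-passing style, because the leaves of a [dtree] can only carry output sets. *)
Definition prog (A : Type) : Type := (A -> dtree n) -> dtree n.

Definition pret A (a : A) : prog A := fun K => K a.
Definition pbind A B (m : prog A) (f : A -> prog B) : prog B := fun K => m (fun a => f a K).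
Definition pask (i j : 'I_n) : prog bool := DQuery i j.

Fixpoint pmap A B (f : A -> prog B) (s : seq A) : prog (seq B) :=
  if s is x :: s' then pbind (f x) (fun b => pbind (pmap f s') (fun bs => pret (b :: bs)))
  else pret [::].

Fixpoint pfold A B (f : B -> A -> prog B) (b : B) (s : seq A) : prog B :=
  if s is x :: s' then pbind (f b x) (fun b' => pfold f b' s') else pret b.

(** A program creates no leaves of its own, so the continuation alone decides their sizes. *)
Definition keeps_size A (m : prog A) : Prop := forall c K,
  (forall a, leaves_size c (K a)) -> leaves_size c (m K).

Lemma keeps_size_bind A B (m : prog A) (f : A -> prog B) :
  keeps_size m -> (forall a, keeps_size (f a)) -> keeps_size (pbind m f).
Proof. by move=> hm hf c K hK; apply: hm => a; apply: hf. Qed.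

Lemma keeps_size_ask_ret A (F : bool -> A) i j :
  keeps_size (pbind (pask i j) (fun b => pret (F b))).
Proof. by move=> c K hK b; apply: hK. Qed.

Lemma keeps_size_map A B (f : A -> prog B) s :
  (forall a, keeps_size (f a)) -> keeps_size (pmap f s).
Proof.
move=> hf; elim: s => [|x s IH] c K hK; first exact: hK.
by apply: hf => b; apply: IH => bs; apply: hK.
Qed.

Lemma keeps_size_fold A B (f : B -> A -> prog B) b s :
  (forall b a, keeps_size (f b a)) -> keeps_size (pfold f b s).
Proof.
move=> hf; elim: s b => [|x s IH] b c K hK; first exact: hK.
by apply: hf => b'; apply: IH.
Qed.

Variable T : 'I_n -> 'I_n -> bool.

Definition computes A (m : prog A) (a : A) (q : nat) : Prop := forall K,
  run T (m K) = ((run T (K a)).1, q + (run T (K a)).2).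

Lemma computes_ret A (a : A) : computes (pret a) a 0.
Proof. by move=> K; rewrite /pret add0n; case: run. Qed.

Lemma computes_bind A B (m : prog A) (f : A -> prog B) a b q r :
  computes m a q -> computes (f a) b r -> computes (pbind m f) b (q + r).
Proof. by move=> hm hf K; rewrite /pbind hm hf /= addnA. Qed.

Lemma computes_ask i j : computes (pask i j) (T i j) 1.
Proof. by []. Qed.

Lemma computes_ask_ret A (F : bool -> A) i j :
  computes (pbind (pask i j) (fun b => pret (F b))) (F (T i j)) 1.
Proof.
rewrite -[1]addn0; apply: computes_bind; first exact: computes_ask.
exact: computes_ret.
Qed.

Lemma computes_map A B (f : A -> prog B) (g : A -> B) q s :
  (forall a, computes (f a) (g a) q) -> computes (pmap f s) (map g s) (size s * q).
Proof.
move=> hf; elim: s => [|x s IH] /=; first exact: computes_ret.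
rewrite mulSn -[size s * q]addn0; apply: computes_bind (hf x) _.
by apply: computes_bind IH _; apply: computes_ret.
Qed.

Lemma computes_fold A B (f : B -> A -> prog B) (g : B -> A -> B) q b s :
  (forall b a, computes (f b a) (g b a) q) -> computes (pfold f b s) (foldl g b s) (size s * q).
Proof.
move=> hf; elim: s b => [|x s IH] b /=; first exact: computes_ret.
by rewrite mulSn; apply: computes_bind (hf b x) _.
Qed.

Definition pchampion (p : 'I_n) (l : seq 'I_n) : prog 'I_n :=
  pfold (fun p y => pbind (pask y p) (fun b => pret (if b then y else p))) p l.

Lemma computes_champion p l : computes (pchampion p l) (champion T p l) (size l).
Proof.
rewrite -[size l]muln1; apply: computes_fold => b a.
exact: computes_ask_ret.
Qed.

Lemma keeps_size_champion p l : keeps_size (pchampion p l).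
Proof.
by apply: keeps_size_fold => b a; apply: keeps_size_ask_ret.
Qed.

Definition pfilter (f : 'I_n -> prog bool) (X : {set 'I_n}) : prog {set 'I_n} :=
  pbind (pmap f (enum X)) (fun bs => pret [set x in mask bs (enum X)]).

Lemma computes_filter f (g : pred 'I_n) q X :
  (forall x, computes (f x) (g x) q) -> computes (pfilter f X) [set x in X | g x] (#|X| * q).
Proof.
move=> hf; rewrite -[_ * _]addn0 cardE; apply: computes_bind; first exact: computes_map.
rewrite -filter_mask.
have -> : [set x in X | g x] = [set x in filter g (enum X)].
  by apply/setP => x; rewrite !inE mem_filter mem_enum andbC.
exact: computes_ret.
Qed.

Lemma keeps_size_filter f X : (forall x, keeps_size (f x)) -> keeps_size (pfilter f X).
Proof.
move=> hf; apply: keeps_size_bind; first exact: keeps_size_map.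
by move=> a c K hK; apply: hK.
Qed.

Definition pabove (p : 'I_n) : prog {set 'I_n} :=
  pfilter (fun x => pbind (pask x p) (fun b => pret ((x == p) || b))) [set: 'I_n].

Definition above (p : 'I_n) : {set 'I_n} := [set x | (x == p) || T x p].

Lemma computes_above p : computes (pabove p) (above p) n.
Proof.
have E : #|[set: 'I_n]| * 1 = n by rewrite cardsT card_ord muln1.
rewrite -[X in computes _ _ X]E.
have -> : above p = [set x in [set: 'I_n] | (x == p) || T x p] by apply/setP => x; rewrite !inE.
apply: computes_filter => x.
exact: computes_ask_ret.
Qed.

Lemma keeps_size_above p : keeps_size (pabove p).
Proof.
by apply: keeps_size_filter => x; apply: keeps_size_ask_ret.
Qed.

Definition sample_losses (v : seq 'I_n) (x : 'I_n) : nat := count (fun y => edge T y x) v.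

(** When the sample contains [x] itself the query is still made and its answer discarded, so that
    each [x] costs exactly [size v] queries. *)
Definition psift (g : nat -> bool) (v : seq 'I_n) (X : {set 'I_n}) : prog {set 'I_n} :=
  pfilter (fun x =>
    pbind (pmap (fun y => pbind (pask y x) (fun b => pret ((y != x) && b))) v)
      (fun bs => pret (g (count id bs)))) X.

Lemma computes_sift g v X :
  computes (psift g v X) [set x in X | g (sample_losses v x)] (#|X| * size v).
Proof.
apply: computes_filter => x; rewrite -[size v]addn0 -[size v]muln1.
apply: computes_bind.
  apply: (@computes_map _ _ _ (fun y => edge T y x)) => y.
  exact: computes_ask_ret.
by rewrite count_map; apply: computes_ret.
Qed.

Lemma keeps_size_sift g v X : keeps_size (psift g v X).
Proof.
apply: keeps_size_filter => x; apply: keeps_size_bind; last by move=> a c K hK; apply: hK.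
by apply: keeps_size_map => y; apply: keeps_size_ask_ret.
Qed.

End Programs.
Import Order.TTheory GRing.Theory Num.Theory.
Local Open Scope ring_scope.

(** * Uniform probability on finite types *)

Section Probability.
Implicit Types Om : finType.

Definition Pr Om (P : pred Om) : R := (#|P|%:R / #|Om|%:R)%R.

Lemma Pr_ge0 Om (P : pred Om) : 0 <= Pr P.
Proof. by rewrite divr_ge0. Qed.

Lemma PrS Om (P Q : pred Om) : (forall w, P w -> Q w) -> Pr P <= Pr Q.
Proof.
move=> h; rewrite ler_wpM2r ?invr_ge0 // ler_nat.
by apply: subset_leq_card; apply/subsetP => w; apply: h.
Qed.

Lemma Pr_or Om (P Q : pred Om) : Pr [pred w | P w || Q w] <= Pr P + Pr Q.
Proof.
rewrite -mulrDl ler_wpM2r ?invr_ge0 // -natrD ler_nat.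
by rewrite -cardUI; apply: leq_trans (leq_addr _ _); apply: subset_leq_card; apply/subsetP.
Qed.

Lemma Pr_sumE Om (P : pred Om) : Pr P = (\sum_w (P w)%:R) / #|Om|%:R.
Proof.
rewrite /Pr -sum1_card natr_sum big_mkcond /=; congr (_ / _).
by apply: eq_bigr => w _; rewrite unfold_in; case: (P w).
Qed.

Lemma Pr_exists Om (I : finType) (A : {set I}) (P : I -> pred Om) (a : R) :
  (forall i, i \in A -> Pr (P i) <= a) -> Pr [pred w | [exists i in A, P i w]] <= #|A|%:R * a.
Proof.
move=> h; rewrite mulr_natl -sumr_const; apply: le_trans (ler_sum _ h).
rewrite Pr_sumE (eq_bigr _ (fun i _ => Pr_sumE (P i))) -mulr_suml exchange_big /=.
rewrite ler_wpM2r ?invr_ge0 //; apply: ler_sum => w _.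
case: existsP => [[i /andP[iA Pi]]|_]; last by apply: sumr_ge0.
by rewrite (bigD1 i) //= Pi lerDl; apply: sumr_ge0.
Qed.

(** Markov's inequality, in the form used for Chernoff bounds. *)
Lemma Pr_le_mean Om (P : pred Om) (g : Om -> R) :
  (forall w, 0 <= g w) -> (forall w, P w -> 1 <= g w) -> Pr P <= (\sum_w g w) / #|Om|%:R.
Proof.
move=> g0 g1; rewrite Pr_sumE ler_wpM2r ?invr_ge0 //; apply: ler_sum => w _.
by case Pw: (P w); [apply: g1|apply: g0].
Qed.

(** Union bound for consecutive stages with independent seeds: the second failure only has to be
    rare once the first stage has succeeded. Summing over the first seed reduces it to a bound for
    each value. *)
Lemma Pr_pair Om1 Om2 (P : pred Om1) (Q : Om1 -> pred Om2) (a b : R) :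
  0 <= b -> Pr P <= a -> (forall w, ~~ P w -> Pr (Q w) <= b) ->
  Pr [pred w : Om1 * Om2 | P w.1 || Q w.1 w.2] <= a + b.
Proof.
move=> b0 hP hQ.
(* Over an empty factor the probability is 0, since division by zero gives 0. *)
have [c1|c1] := posnP #|{: Om1}|.
  by rewrite /Pr card_prod c1 mul0n mulr0n invr0 mulr0 addr_ge0 // (le_trans (Pr_ge0 P)).
have [c2|c2] := posnP #|{: Om2}|.
  by rewrite /Pr card_prod c2 muln0 mulr0n invr0 mulr0 addr_ge0 // (le_trans (Pr_ge0 P)).
have c1r : 0 < (#|{: Om1}|%:R : R) by rewrite ltr0n.
have c2r : 0 < (#|{: Om2}|%:R : R) by rewrite ltr0n.
have -> : Pr [pred w : Om1 * Om2 | P w.1 || Q w.1 w.2] =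
    (\sum_w Pr [pred w2 | P w || Q w w2]) / #|{: Om1}|%:R.
  rewrite Pr_sumE (eq_bigr _ (fun w _ => Pr_sumE _)) -mulr_suml pair_bigA /=.
  by rewrite card_prod natrM invfM -mulrA [_^-1 * _]mulrC.
rewrite ler_pdivrMr //.
apply: (@le_trans _ _ (\sum_w ((P w)%:R + b))).
  apply: ler_sum => w _; case Pw: (P w) => /=.
    apply: (@le_trans _ _ 1); last by rewrite lerDl.
    by rewrite ler_pdivrMr // mul1r ler_nat max_card.
  by rewrite add0r; apply: le_trans (hQ w _); rewrite ?Pw //; apply: PrS.
rewrite big_split /= sumr_const mulrDl [b * _]mulr_natr lerD2r.
by move: hP; rewrite Pr_sumE ler_pdivrMr.
Qed.

Lemma sum_modn (N m : nat) (F : nat -> R) : (m %| N)%N ->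
  \sum_(i < N) F (i %% m)%N = (N %/ m)%:R * \sum_(j < m) F j.
Proof.
move=> mN; rewrite -(big_mkord xpredT (fun i => F (i %% m)%N)) -{1}(divnK mN) big_nat_mul.
rewrite (eq_bigr (fun=> \sum_(j < m) F j)); first by rewrite sumr_const_nat subn0 mulr_natl.
move=> i _; rewrite -{1}[(i * m)%N]add0n big_addn mulSn addnK big_mkord.
by apply: eq_bigr => j _; rewrite addnC modnMDl modn_small.
Qed.

Lemma Pr_modn (N m : nat) (P : pred nat) : (0 < m)%N -> (0 < N)%N -> (m %| N)%N ->
  Pr [pred i : 'I_N | P (i %% m)%N] = #|[pred j : 'I_m | P j]|%:R / m%:R.
Proof.
move=> m0 N0 mN; rewrite Pr_sumE (@sum_modn N m (fun i => (P i)%:R)) // card_ord.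
rewrite -{2}(divnK mN) natrM invfM mulrACA mulfV ?mul1r; last first.
  by rewrite pnatr_eq0 -lt0n divn_gt0 // dvdn_leq.
congr (_ / _); rewrite -sum1_card natr_sum [RHS]big_mkcond /=.
by apply: eq_bigr => j _; rewrite unfold_in /=; case: (P j).
Qed.

End Probability.

Section Exponential.
Implicit Types x y : R.

Lemma expr_gt0 x : 0 < exp x.
Proof. by apply/RltP; apply: exp_pos. Qed.

Lemma ler_exp x y : x <= y -> exp x <= exp y.
Proof.
by rewrite le_eqVlt => /orP[/eqP->//|/RltP h]; apply/ltW/RltP; apply: exp_increasing.
Qed.

Lemma exp_ge1D x : 1 + x <= exp x.
Proof. by apply/RleP; apply: exp_ineq1_le. Qed.

Lemma exp_add x y : exp (x + y)%R = exp x * exp y.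
Proof. exact: exp_plus. Qed.

Lemma exp_zero : exp 0%R = 1.
Proof. exact: exp_0. Qed.

Lemma exp_mul_nat (m : nat) x : exp (m%:R * x)%R = exp x ^+ m.
Proof.
elim: m => [|m IH]; first by rewrite mul0r exp_zero expr0.
by rewrite exprS -IH -exp_add -natr1 mulrDl mul1r addrC.
Qed.

End Exponential.

(** * Independent samples and their tail bounds *)

Section Sampling.
Variables (n N : nat).
Hypothesis N0 : (0 < N)%N.

(* A seed [i], uniform below a multiple [N] of [#|X|], yields a uniform element of [X]. *)
Definition pick_elt (X : {set 'I_n.+1}) (i : nat) : 'I_n.+1 := nth ord0 (enum X) (i %% #|X|).

Definition sample r (X : {set 'I_n.+1}) (w : {ffun 'I_r -> 'I_N}) : seq 'I_n.+1 :=
  [seq pick_elt X (w j) | j <- enum 'I_r].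

Lemma size_sample r X (w : {ffun 'I_r -> 'I_N}) : size (sample X w) = r.
Proof. by rewrite size_map size_enum_ord. Qed.

Variable X : {set 'I_n.+1}.
Hypotheses (X0 : (0 < #|X|)%N) (XN : (#|X| %| N)%N).

Lemma sum_pick_elt (F : 'I_n.+1 -> R) :
  \sum_(i < N) F (pick_elt X i) = N%:R * ((\sum_(x in X) F x) / #|X|%:R).
Proof.
rewrite (@sum_modn N #|X| (fun i => F (nth ord0 (enum X) i))) //.
rewrite -[in RHS](divnK XN) natrM -mulrA; congr (_ * _).
rewrite mulrCA mulfV ?mulr1 ?pnatr_eq0 -?lt0n //.
by rewrite -[RHS]big_enum /= (big_nth ord0) -cardE big_mkord.
Qed.

(** Independence of the draws: a product of sums expands into a sum over all seed functions. *)
Lemma mean_prod_sample r (G : 'I_n.+1 -> R) :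
  (\sum_(w : {ffun 'I_r -> 'I_N}) \prod_(x <- sample X w) G x) / #|{: {ffun 'I_r -> 'I_N}}|%:R
  = ((\sum_(x in X) G x) / #|X|%:R) ^+ r.
Proof.
rewrite card_ffun !card_ord.
under eq_bigr => w _ do rewrite big_map big_enum /=.
rewrite -(bigA_distr_bigA (fun (_ : 'I_r) (i : 'I_N) => G (pick_elt X i))) /= sum_pick_elt.
rewrite prodr_const card_ord exprMn natrX mulrAC mulfV ?mul1r //.
by rewrite expf_neq0 // pnatr_eq0 -lt0n.
Qed.

Variable e : pred 'I_n.+1.
Let p : R := (#|[set x in X | e x]|%:R / #|X|%:R)%R.

Lemma mean_two_values (a : R) : (\sum_(x in X) (if e x then 1 + a else 1)) / #|X|%:R = 1 + a * p.
Proof.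
have X0R : #|X|%:R != 0 :> R by rewrite pnatr_eq0 -lt0n.
rewrite (eq_bigr (fun x => 1 + (if e x then a else 0))); last by move=> x _; case: (e x); rewrite ?addr0.
rewrite big_split /= sumr_const mulrDl mulfV //; congr (_ + _).
rewrite -big_mkcondr /= (eq_bigl (fun x => x \in [set x in X | e x])); last by move=> x; rewrite inE.
by rewrite sumr_const -[a *+ _]mulr_natr -mulrA.
Qed.

(** With factors 0 on [e] and 1 elsewhere, the product over the sample indicates that nothing is
    hit; its mean [(1 - p) ^+ r] is bounded below by Bernoulli's inequality. *)
Lemma prob_sample_hits r :
  Pr [pred w : {ffun 'I_r -> 'I_N} | has e (sample X w)] <= r%:R * p.
Proof.
have bern (q : R) : 0 <= q -> q <= 1 -> 1 - r%:R * q <= (1 - q) ^+ r.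
  move=> q0 q1; elim: r => [|m IH]; first by rewrite expr0 mul0r subr0.
  rewrite exprS -natr1; apply: le_trans (ler_wpM2l _ IH); last by rewrite subr_ge0.
  have : 0 <= (m%:R : R) by []. nra.
have p0 : 0 <= p by rewrite divr_ge0.
have p1 : p <= 1.
  rewrite ler_pdivrMr ?ltr0n // mul1r ler_nat subset_leq_card //.
  by apply/subsetP => x; rewrite inE => /andP[].
have := mean_prod_sample r (fun x => if e x then 1 + (-1) else 1).
rewrite mean_two_values mulN1r => E.
have := bern p p0 p1; rewrite -E Pr_sumE.
have WN : #|{: {ffun 'I_r -> 'I_N}}|%:R != 0 :> R.
  by rewrite card_ffun !card_ord pnatr_eq0 -lt0n expn_gt0 N0.
suff -> : \sum_(w : {ffun 'I_r -> 'I_N}) \prod_(x <- sample X w) (if e x then 1 + -1 else 1 : R)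
   = #|{: {ffun 'I_r -> 'I_N}}|%:R - \sum_(w : {ffun 'I_r -> 'I_N}) (has e (sample X w))%:R.
  by rewrite mulrBl mulfV //; set a := _ / _; lra.
rewrite -sum1_card natr_sum -sumrB; apply: eq_bigr => w _ /=.
elim: (sample X w) => [|x s IH]; first by rewrite big_nil subr0.
by rewrite big_cons IH /=; case: (e x); rewrite ?mul1r // subrr mul0r.
Qed.

(* The Chernoff bound for both tails: upper for [0 < a, t], lower for [a, t < 0]. *)
Lemma prob_sample_count r (a t B D : R) : exp t <= 1 + a -> a * p <= D ->
  Pr [pred w : {ffun 'I_r -> 'I_N} | B <= t * (count e (sample X w))%:R]
    <= exp (r%:R * D - B)%R.
Proof.
move=> ta aD.
have a1 : 0 <= 1 + a by apply: le_trans ta; apply/ltW/expr_gt0.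
(* Markov for [exp (- B)] times [1 + a] to the number of hits. On the event this is at least
   [exp (t * count - B) >= 1], and its mean is [exp (- B) * (1 + a * p) ^+ r]. *)
apply: le_trans (@Pr_le_mean _ _
  (fun w => exp (- B)%R * \prod_(x <- sample X w) (if e x then 1 + a else 1))%R _ _) _.
- by move=> w; apply: mulr_ge0; [exact/ltW/expr_gt0|apply: prodr_ge0 => x _; case: ifP].
- move=> w /= hB.
  have -> : \prod_(x <- sample X w) (if e x then 1 + a else 1) = (1 + a) ^+ (count e (sample X w)).
    elim: (sample X w) => [|x s IH]; first by rewrite big_nil expr0.
    by rewrite big_cons IH /=; case: (e x); rewrite ?add0n ?mul1r // add1n exprS.
  apply: (@le_trans _ _ (exp (- B)%R * exp t ^+ count e (sample X w))).
    rewrite -exp_mul_nat -exp_add -[leLHS]exp_zero; apply: ler_exp.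
    by move: hB; rewrite mulrC; set u := _ * t; lra.
  apply: ler_wpM2l; first exact/ltW/expr_gt0.
  by rewrite lerXn2r // nnegrE; apply/ltW/expr_gt0.
rewrite -mulr_sumr -mulrA mean_prod_sample mean_two_values [r%:R * D - B]addrC exp_add.
apply: ler_wpM2l; first exact/ltW/expr_gt0.
rewrite exp_mul_nat.
apply: (@le_trans _ _ (exp (a * p)%R ^+ r)); last first.
  by rewrite lerXn2r ?nnegrE ?(ltW (expr_gt0 _)) // ler_exp.
have h : 0 <= 1 + a * p.
  by rewrite -mean_two_values divr_ge0 // sumr_ge0 // => x _; case: ifP.
by rewrite lerXn2r ?nnegrE ?(ltW (expr_gt0 _)) ?exp_ge1D.
Qed.

End Sampling.

(** Supplies [t = d - d ^+ 2] for [a = d] in the upper tail. It follows from [exp t <= 1 / (1 - t)]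
    and [(1 + d) (1 - d + d^2) = 1 + d^3]. *)
Lemma exp_le_1D (d : R) : 0 <= d -> d <= 1 / 4%:R -> exp (d - d ^+ 2)%R <= 1 + d.
Proof.
move=> d0 d1; have := exp_ge1D (- (d - d ^+ 2))%R.
have := exp_add (d - d ^+ 2)%R (- (d - d ^+ 2))%R; rewrite subrr exp_zero.
have := expr_gt0 (d - d ^+ 2)%R; set x := exp _; set y := exp _ => x0 xy y1.
have : x * (1 + - (d - d ^+ 2)) <= 1 by rewrite [leRHS]xy ler_wpM2l // ltW.
nra.
Qed.

(** The lower-tail counterpart, for [a = - d]; here [(1 - d) (1 + d + 2 d^2) = 1 + d^2 (1 - 2
    d)]. *)
Lemma exp_le_1B (d : R) : 0 <= d -> d <= 1 / 4%:R -> exp (- (d + 2%:R * d ^+ 2))%R <= 1 - d.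
Proof.
move=> d0 d1; have := exp_ge1D (d + 2%:R * d ^+ 2)%R.
have := exp_add (- (d + 2%:R * d ^+ 2))%R (d + 2%:R * d ^+ 2)%R; rewrite addNr exp_zero.
have := expr_gt0 (- (d + 2%:R * d ^+ 2))%R; set x := exp _; set y := exp _ => x0 xy y1.
have : x * (1 + (d + 2%:R * d ^+ 2)) <= 1 by rewrite [leRHS]xy ler_wpM2l // ltW.
have : 1 <= (1 - d) * (1 + (d + 2%:R * d ^+ 2)) by nra.
nra.
Qed.

(** * Failure probabilities of sifting and of the pivot stage *)

Section Stages.
Variables (n k N : nat) (T : 'I_n.+1 -> 'I_n.+1 -> bool) (K : {set 'I_n.+1}) (u : 'I_n.+1).
Hypotheses (N0 : (0 < N)%N) (XN : forall X : {set 'I_n.+1}, (0 < #|X|)%N -> (#|X| %| N)%N).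
Hypotheses (tT : tournament T) (cK : #|K| = k) (acT : acyclic_on T (~: K)).
Hypothesis maxu : uncorrupted_max T K u.

Lemma losses_max X : (losses T X u <= k)%N.
Proof.
rewrite -cK; apply: subset_leq_card; apply/subsetP => y; rewrite inE => /andP[_ eyu].
apply: contraTT eyu => yK; have [->|nyu] := eqVneq y u; first by rewrite /edge eqxx.
by apply: edgeN => //; apply: maxu.2 => //; rewrite inE.
Qed.

(* The threshold [c <= (1 + 2d) r k / m] for [d = 1 / (4h)]. *)
Definition sift_test (h r m : nat) : pred nat := fun c => (2 * h * m * c <= (2 * h + 1) * r * k)%N.

Definition sifted h (X : {set 'I_n.+1}) (v : seq 'I_n.+1) : {set 'I_n.+1} :=
  [set x in X | sift_test h (size v) #|X| (sample_losses T v x)].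

(** If no element is misjudged, all survivors have at most [(1 + 6d) k] losses for [d = 1 / (4h)],
    and [card_le_losses] bounds their number. Each misjudgement has probability at most
    [exp (- 3 lam)], whence a union bound over [X]. *)
Lemma sifted_ok (b h lam r : nat) (X : {set 'I_n.+1}) :
  (0 < k)%N -> (0 < h)%N -> (#|X| <= b * k)%N -> u \in X ->
  r = (96 * h ^ 2 * lam * b)%N ->
  Pr [pred w : {ffun 'I_r -> 'I_N} |
      ~~ ((u \in sifted h X (sample X w)) &&
          (h * #|sifted h X (sample X w)| <= h * (2 * k + 1) + 3 * k)%N)]
  <= #|X|%:R * exp (- (3 * lam)%N%:R)%R.
Proof.
move=> k0 h0 Xb uX hr.
have X0 : (0 < #|X|)%N by rewrite card_gt0; apply/set0Pn; exists u.
have XN' := XN X0.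
(* Misjudging means rejecting [u], or accepting another element with more than [(1 + 6d) k]
   losses. *)
pose bad x (w : {ffun 'I_r -> 'I_N}) :=
  if x == u then ~~ sift_test h r #|X| (sample_losses T (sample X w) x)
  else (2 * h * k + 3 * k < 2 * h * losses T X x)%N &&
       sift_test h r #|X| (sample_losses T (sample X w) x).
apply: le_trans (@Pr_exists _ _ X bad _ _) => /=.
  apply: PrS => w /=; apply: contraR => /existsPn nb.
  have good x : x \in X -> ~~ bad x w by move=> xX; have := nb x; rewrite xX.
  have uZ : u \in sifted h X (sample X w).
    by rewrite inE uX size_sample; have := good u uX; rewrite /bad eqxx negbK.
  rewrite uZ /=.
  have : (#|sifted h X (sample X w)| <= ((2 * h * k + 3 * k) %/ (2 * h)).*2.+1)%N.
    apply: (@card_le_losses _ _ tT X); first by apply/subsetP => x; rewrite inE => /andP[].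
    move=> x; rewrite inE size_sample => /andP[xX tx]; have := good x xX; rewrite /bad.
    rewrite leq_divRL ?muln_gt0 // [(losses _ _ _ * _)%N]mulnC.
    case: eqP => [->|_]; last by rewrite tx andbT -leqNgt.
    move=> _; have := losses_max X; nia.
  have := leq_trunc_div (2 * h * k + 3 * k) (2 * h); set q := (_ %/ _)%N => hq.
  by rewrite -(leq_pmul2l h0) => hZ; apply: leq_trans hZ _; nia.
move=> x xX.
have h0R : 1 <= (h%:R : R) by rewrite ler1n.
pose d : R := (1 / (4 * h)%N%:R)%R.
pose y : R := ((r * k)%N%:R / #|X|%:R)%R.
have mR : 0 < (#|X|%:R : R) by rewrite ltr0n.
have hd : d * (4%:R * h%:R) = 1.
  by rewrite /d natrM mul1r mulVf // mulf_neq0 // pnatr_eq0 -?lt0n.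
have d0 : 0 < d by rewrite /d divr_gt0 // ltr0n muln_gt0.
have d1 : d <= 1 / 4%:R by nra.
have y0 : 0 <= y by rewrite divr_ge0.
(* [y] is the expected count of sampled losses for an element with [k] losses; [96 = 6 * 16] and
   [16 h^2 = 1 / d^2]. *)
have yd : 6%:R * lam%:R <= y * d ^+ 2.
  have : (96 * h ^ 2 * lam)%:R <= y.
    by rewrite /y ler_pdivlMr // -natrM ler_nat hr -[leqRHS]mulnA leq_mul2l Xb orbT.
  rewrite 2!natrM natrX.
  have : 0 <= (lam%:R : R) by [].
  have : d ^+ 2 * 16%:R * h%:R ^+ 2 = 1.
    have -> : d ^+ 2 * 16%:R * h%:R ^+ 2 = (d * (4%:R * h%:R)) ^+ 2 by ring.
    by rewrite hd expr1n.
  move=> e1 l0 /(ler_wpM2r (ltW (exprn_gt0 2 d0))).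
  have -> : 96%:R * h%:R ^+ 2 * lam%:R * d ^+ 2 = 6%:R * lam%:R * (d ^+ 2 * 16%:R * h%:R ^+ 2) by ring.
  by rewrite e1 mulr1.
have cut c : sift_test h r #|X| c = (c%:R <= (1 + 2%:R * d) * y).
  rewrite /sift_test -(ler_nat R) /y mulrA ler_pdivlMr // !natrM natrD natrM.
  have h4 : 0 < 2%:R * h%:R :> R by lra.
  rewrite -[RHS](ler_pM2l h4); congr (_ <= _); first by ring.
  have -> : 2%:R * h%:R * ((1 + 2%:R * d) * (r%:R * k%:R)) =
     (2%:R * h%:R + d * (4%:R * h%:R)) * (r%:R * k%:R) by ring.
  by rewrite hd mulrA.
have rD (D : R) : r%:R * (D * k%:R / #|X|%:R) = D * y by rewrite /y natrM; ring.
(* Upper tail for [u], of mean at most [y], against the threshold [(1 + 2d) y]. The exponent is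
   [- y d^2 (1 - 2d)], at most [- 3 lam] since [d <= 1/4]. *)
rewrite /bad; case: eqP => [->|_].
  apply: le_trans (@PrS _ _ [pred w | (d - d ^+ 2) * ((1 + 2%:R * d) * y) <=
     (d - d ^+ 2) * (count (fun y => edge T y u) (sample X w))%:R] _) _.
    move=> w /=; rewrite cut -ltNge => /ltW hw; apply: ler_wpM2l => //; nra.
  apply: le_trans (@prob_sample_count _ _ N0 _ X0 XN' _ r d _ _ (d * k%:R / #|X|%:R)%R _ _) _.
  - by apply: exp_le_1D => //; exact: ltW.
  - rewrite -mulrA; apply: ler_wpM2l; first exact: ltW.
    by rewrite ler_wpM2r ?invr_ge0 // ler_nat; exact: losses_max.
  apply: ler_exp; rewrite rD natrM.
  have : y * d ^+ 2 * (1 - 2%:R * d) >= y * d ^+ 2 * (1 / 2%:R).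
    apply: ler_wpM2l; last lra. by apply: mulr_ge0 => //; apply/exprn_ge0/ltW.
  have -> : d * y - (d - d ^+ 2) * ((1 + 2%:R * d) * y) = - (y * d ^+ 2 * (1 - 2%:R * d)) by ring.
  lra.
case: ltnP => hL /=; last first.
  rewrite (_ : Pr _ = 0) ?ltW ?expr_gt0 //.
  by rewrite /Pr (eq_card0 (A := xpred0)) // mul0r.
(* Lower tail for an element of mean at least [(1 + 6d) y], against the same threshold. The exponent
   is [- y d^2 (2 - 4d)]. *)
apply: le_trans (@PrS _ _ [pred w | (- (d + 2%:R * d ^+ 2)) * ((1 + 2%:R * d) * y) <=
     (- (d + 2%:R * d ^+ 2)) * (count (fun y => edge T y x) (sample X w))%:R] _) _.
  move=> w /=; rewrite cut => hw; apply: ler_wnM2l => //; nra.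
apply: le_trans (@prob_sample_count _ _ N0 _ X0 XN' _ r (- d)%R _ _
   ((- (d * (1 + 6%:R * d))) * k%:R / #|X|%:R)%R _ _) _.
- by apply: exp_le_1B => //; exact: ltW.
- rewrite mulrA; apply: ler_wpM2r; first by rewrite invr_ge0.
  rewrite !mulNr lerN2 -mulrA; apply: ler_wpM2l; first exact: ltW.
  move: (ltnW hL); rewrite -(ler_nat R) natrD !natrM -/(losses T X x) => hL'.
  have h4 : 0 < 2%:R * h%:R :> R by lra.
  rewrite -(ler_pM2l h4); apply: le_trans hL'.
  have -> : 2%:R * h%:R * ((1 + 6%:R * d) * k%:R) =
      2%:R * h%:R * k%:R + 3%:R * (d * (4%:R * h%:R)) * k%:R by ring.
  by rewrite hd mulr1.
apply: ler_exp; rewrite rD natrM.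
have : y * d ^+ 2 * (2%:R - 4%:R * d) >= y * d ^+ 2 * 1.
  apply: ler_wpM2l; last lra. by apply: mulr_ge0 => //; apply/exprn_ge0/ltW.
have -> : - (d * (1 + 6%:R * d)) * y - - (d + 2%:R * d ^+ 2) * ((1 + 2%:R * d) * y) =
    - (y * d ^+ 2 * (2%:R - 4%:R * d)) by ring.
have : 0 <= lam%:R :> R by []. lra.
Qed.

(** Let [W] be the top [t] uncorrupted elements. If the sample avoids [K] and meets [W], its
    champion lies in [W], so everything above it lies in [W] or [K]. The two summands bound hitting
    [K] and missing [W]. *)
Lemma above_champion_ok (s t : nat) : (t <= #|~: K|)%N ->
  Pr [pred w : {ffun 'I_s -> 'I_N} |
      let l := sample [set: 'I_n.+1] w in let p := champion T (head ord0 l) l in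
      ~~ ((u \in above T p) && (#|above T p| <= t + k)%N)]
  <= (s * k)%N%:R / n.+1%:R + exp (- ((s * t)%N%:R / (2 * n.+1)%N%:R))%R.
Proof.
move=> tU; have [W [sWU cW clW]] := exists_top_set tT acT tU.
have nT : #|[set: 'I_n.+1]| = n.+1 by rewrite cardsT card_ord.
have T0 : (0 < #|[set: 'I_n.+1]|)%N by rewrite nT.
have TN := XN T0.
have hits (A : {set 'I_n.+1}) : #|[set x in [set: 'I_n.+1] | mem A x]| = #|A|.
  by apply: eq_card => x; rewrite !inE.
apply: le_trans (@PrS _ _ [pred w : {ffun 'I_s -> 'I_N} | has (mem K) (sample [set: 'I_n.+1] w)
  || (0 <= -1 * (count (mem W) (sample [set: 'I_n.+1] w))%:R :> R)] _) _.
  move=> w /=; set l := sample _ w; set p := champion _ _ _.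
  apply: contraR; rewrite negb_or => /andP[/hasPn nK]; rewrite mulN1r oppr_ge0 -ltNge ltr0n -has_count.
  case/hasP => y yl yW.
  have lU : {subset l <= ~: K} by move=> x xl; rewrite inE; exact: nK.
  (* The sample meets [W], hence is nonempty, and the default [ord0] does not intervene. *)
  have hl : head ord0 l \in l by case: (l) yl => //= a l' _; rewrite mem_head.
  have [pU pmax] := @championP _ _ tT _ acT (head ord0 l) l (lU _ hl) lU.
  have pW : p \in W.
    have [yp|epy] := pmax y (mem_behead (s := _ :: _) yl); first by rewrite /p -yp.
    by apply: (clW y).
  apply/andP; split.
    rewrite inE; case: eqVneq => //= nup.
    by have /andP[] : edge T u p by apply: maxu.2 => //; rewrite eq_sym.
  rewrite -cW -cK; apply: leq_trans (leq_card_setU W K); apply: subset_leq_card.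
  apply/subsetP => x; rewrite !inE => /orP[/eqP->|Txp]; first by rewrite pW.
  case xK : (x \in K); rewrite ?orbT // orbF; have [->//|nxp] := eqVneq x p.
  by apply: (clW p) => //; rewrite ?inE ?xK // /edge nxp.
apply: le_trans (Pr_or _ _) _; apply: lerD.
  apply: le_trans (@prob_sample_hits _ _ N0 _ T0 TN _ _) _.
  by rewrite hits nT cK natrM mulrA.
(* Missing [W] means a count of zero: the tail bound with [B = 0], [t = -1], [a = - 1/2], allowed
   because [exp 1 >= 2]. *)
apply: le_trans (@prob_sample_count _ _ N0 _ T0 TN _ _ (- (1 / 2%:R))%R _ _
    (- (t%:R / (2 * n.+1)%N%:R))%R _ _) _.
- have e1 := exp_ge1D 1%R.
  have e2 : exp 1%R * exp (- 1)%R = 1 by rewrite -exp_add subrr exp_zero.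
  have := expr_gt0 (- 1)%R; move: e1 e2.
  by set a := exp 1%R; set b := exp _ => e1 e2 b0; nra.
- rewrite hits nT cW mulNr lerN2 natrM invfM mul1r.
  by rewrite (_ : t%:R * _ = 2%:R^-1 * (t%:R / n.+1%:R)) // mulrCA.
by apply: ler_exp; rewrite subr0 mulrN mulrA -natrM.
Qed.

End Stages.

(** * Trimming to [2k + 1] elements by a random rotation *)

Lemma add_index_rot (A : eqType) (s : seq A) (x : A) (j : nat) : uniq s -> x \in s ->
  (j < size s)%N -> (j + index x (rot j s) = index x s)%N \/
                    (j + index x (rot j s) = index x s + size s)%N.
Proof.
move=> us xs js; have := us; rewrite -{1}(cat_take_drop j s) cat_uniq => /and3P[_ /hasPn dj _].
have st : size (take j s) = j by rewrite size_takel // ltnW.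
have E : index x s = if x \in take j s then index x (take j s) else (j + index x (drop j s))%N.
  by rewrite -{1}(cat_take_drop j s) index_cat st.
rewrite /rot index_cat size_drop E.
case xd : (x \in drop j s); first by left; rewrite (negbTE (dj x xd)).
have -> : x \in take j s by move: xs; rewrite -{1}(cat_take_drop j s) mem_cat xd orbF.
by right; rewrite addnA subnKC ?(ltnW js) // addnC.
Qed.

Lemma index_rot_inj (A : eqType) (s : seq A) (x : A) (i j : nat) : uniq s -> x \in s ->
  (i < size s)%N -> (j < size s)%N -> index x (rot i s) = index x (rot j s) -> i = j.
Proof.
move=> us xs li lj eij; have hi := add_index_rot us xs li.
by have := add_index_rot us xs lj; rewrite -eij => hj; lia.
Qed.

Section Trim.
Variables (n k N : nat) (u : 'I_n.+1).
Hypotheses (N0 : (0 < N)%N) (XN : forall X : {set 'I_n.+1}, (0 < #|X|)%N -> (#|X| %| N)%N).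

(** A random rotation replaces a random subset: only the position of [u] must be uniform. The
    complement of [X] pads the list when [X] is too small. *)
Definition trim (X : {set 'I_n.+1}) (i : nat) : {set 'I_n.+1} :=
  [set x in take (2 * k + 1) (rot (i %% #|X|) (enum X) ++ enum (~: X))].

Lemma card_trim X i : (2 * k + 1 <= n.+1)%N -> #|trim X i| = (2 * k + 1)%N.
Proof.
move=> hk; rewrite /trim; set s := _ ++ _.
have us : uniq s.
  rewrite cat_uniq rot_uniq !enum_uniq andbT /=; apply/hasPn => x.
  by rewrite mem_rot !mem_enum inE.
have ss : size s = n.+1 by rewrite size_cat size_rot -!cardE cardsC card_ord.
rewrite cardsE; move/card_uniqP: (take_uniq (2 * k + 1) us) => ->.
by rewrite size_takel // ss.
Qed.

(** Distinct rotations put [u] at distinct positions, so at most [#|X| - (2k + 1)] of them push it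
    past the cut. *)
Lemma trim_ok (X : {set 'I_n.+1}) : u \in X ->
  Pr [pred i : 'I_N | u \notin trim X i] <= (#|X| - (2 * k + 1))%N%:R / #|X|%:R.
Proof.
move=> uX; have X0 : (0 < #|X|)%N by rewrite card_gt0; apply/set0Pn; exists u.
pose f j := index u (rot j (enum X)).
have uE : u \in enum X by rewrite mem_enum.
apply: le_trans (@PrS _ _ [pred i : 'I_N | 2 * k + 1 <= f (i %% #|X|)]%N _) _.
  move=> i /=; apply: contraR; rewrite -ltnNge => fi.
  have uR : u \in rot (i %% #|X|) (enum X) by rewrite mem_rot.
  have uC : u \in rot (i %% #|X|) (enum X) ++ enum (~: X) by rewrite mem_cat uR.
  by rewrite inE (in_take _ uC) index_cat uR.
rewrite (@Pr_modn N #|X| (fun j => 2 * k + 1 <= f j)%N X0 N0 (XN X0)).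
rewrite ler_wpM2r ?invr_ge0 // ler_nat.
set A := [pred _ | _].
have -> : #|A| = size [seq f (val j) | j <- enum A] by rewrite size_map -cardE.
rewrite -(size_iota (2 * k + 1) (#|X| - (2 * k + 1))); apply: uniq_leq_size.
  rewrite map_inj_in_uniq ?enum_uniq // => i j _ _ fij; apply: val_inj => /=.
  by apply: (index_rot_inj (enum_uniq X) uE) fij; rewrite -cardE; exact: ltn_ord.
have fX j : (f j < #|X|)%N by rewrite cardE -(size_rot j) index_mem mem_rot.
move=> q /mapP[j]; rewrite mem_enum inE => hj ->; rewrite mem_iota hj /=.
by rewrite subnKC // (leq_trans hj) // ltnW.
Qed.

End Trim.

(** * The algorithm *)

Section UniformTrees.
Variables (n : nat) (Om : finType) (A : Om -> dtree n).

Definition uniform_randalg : randalg n :=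
  [seq (Rinv (INR #|Om|), A w) | w <- enum Om].

Hypothesis Om0 : (0 < #|Om|)%N.

Lemma valid_uniform_randalg m :
  (forall w, leaves_size m (A w)) -> valid_randalg m uniform_randalg.
Proof.
have c0 : Rlt 0 (INR #|Om|) by apply: lt_0_INR; apply/ssrnat.ltP.
move=> hA; split.
  move=> x t; rewrite /uniform_randalg; elim: (enum Om) => //= w s IH [[<- <-]|/IH //].
  by split=> //; apply/Rlt_le/Rinv_0_lt_compat.
have -> : total_weight uniform_randalg = Rmult (INR (size (enum Om))) (Rinv (INR #|Om|)).
  rewrite /uniform_randalg; elim: (enum Om) => [|w s IH]; first by rewrite Rmult_0_l.
  by rewrite [size _]/= S_INR Rmult_plus_distr_r Rmult_1_l Rplus_comm -IH.
by rewrite -cardE; apply: Rinv_r; apply: Rgt_not_eq.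
Qed.

Lemma prob_uniform_randalg T (E : {set 'I_n} * nat -> Prop) (B : pred Om) :
  (forall w, ~~ B w -> E (run T (A w))) -> 1 - Pr B <= prob uniform_randalg T E.
Proof.
move=> hE.
have c0 : 0 < #|Om|%:R :> R by rewrite ltr0n.
have : (size (enum Om))%:R / #|Om|%:R - (count B (enum Om))%:R / #|Om|%:R
    <= prob uniform_randalg T E.
  rewrite /uniform_randalg; elim: (enum Om) => [|w s IH]; first by rewrite !mul0r subrr.
  rewrite [map _ _]/=; set p := prob _ T E in IH.
  have -> : prob ((Rinv (INR #|Om|), A w) :: [seq (Rinv (INR #|Om|), A w) | w <- s]) T E
      = #|Om|%:R^-1 * indicator (E (run T (A w))) + p by rewrite -INRE.
  rewrite /= -natr1 natrD !mulrDl mul1r.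
  have i0 : 0 < #|Om|%:R^-1 :> R by rewrite invr_gt0.
  have : #|Om|%:R^-1 * (1 - (B w)%:R) <= #|Om|%:R^-1 * indicator (E (run T (A w))).
    apply: ler_wpM2l; first exact: ltW.
    rewrite /indicator; case: ClassicalEpsilon.excluded_middle_informative => [Ew|nE].
      by case: (B w); rewrite ?subr0 // subrr.
    by case Bw: (B w); [rewrite subrr|case: nE; apply: hE; rewrite Bw].
  rewrite mulrBr mulr1 [_^-1 * (B w)%:R]mulrC; set x := _ * indicator _.
  by set y := _ / _ in IH *; set z := _ / _ in IH *; set v := (B w)%:R / _; lra.
have cB : #|B| = count B (enum Om) by rewrite enumT cardE size_filter.
by rewrite -cardE mulfV ?gt_eqF // /Pr cB.
Qed.

End UniformTrees.

(* Discarding oversized sets makes the query bound deterministic. *)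
Definition clip n (M : nat) (X : {set 'I_n}) : {set 'I_n} := if (#|X| <= M)%N then X else set0.

Lemma card_clip n M (X : {set 'I_n}) : (#|clip M X| <= M)%N.
Proof. by rewrite /clip; case: ifP => //; rewrite cards0. Qed.

Section Algorithm.
Variables (n k kap lam : nat).

(** The factorial is divisible by every possible size of a nonempty set, so seeds can be drawn
    before the sets are known. *)
Definition seedN : nat := n.+1`!.
Definition pivot_sample : nat := (n.+1 * lam) %/ (k * kap).
(** Both sifting samples have the size required by [sifted_ok]: [h = 1], [b = 8 * kap] here, then
    [h = kap], [b = 6]. *)
Definition coarse_sample : nat := (96 * 1 ^ 2 * lam * (8 * kap))%N.
Definition fine_sample : nat := (96 * kap ^ 2 * lam * 6)%N.

Definition seeds : finType :=
  ({ffun 'I_pivot_sample -> 'I_seedN} * ({ffun 'I_coarse_sample -> 'I_seedN} *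
    ({ffun 'I_fine_sample -> 'I_seedN} * 'I_seedN)))%type.

Definition ppivot (w : {ffun 'I_pivot_sample -> 'I_seedN}) : prog n.+1 {set 'I_n.+1} :=
  if (n.+1 <= 8 * kap * k)%N then pret [set: 'I_n.+1]
  else let l := sample [set: 'I_n.+1] w in
       pbind (pchampion (head ord0 l) l) (@pabove n.+1).

Definition psifted h r (X : {set 'I_n.+1}) (w : {ffun 'I_r -> 'I_seedN}) : prog n.+1 {set 'I_n.+1} :=
  psift (sift_test k h r #|X|) (sample X w) X.

Definition algorithm (w : seeds) : dtree n.+1 :=
  pbind (ppivot w.1) (fun X1 =>
  pbind (psifted 1 (clip (8 * kap * k) X1) w.2.1) (fun X2 =>
  psifted kap (clip (6 * k) X2) w.2.2.1))
  (fun X3 => DLeaf (trim k X3 w.2.2.2)).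

Lemma algorithm_leaves w : (2 * k + 1 <= n.+1)%N -> leaves_size (2 * k + 1) (algorithm w).
Proof.
move=> hk.
suff ks : keeps_size (pbind (ppivot w.1) (fun X1 =>
    pbind (psifted 1 (clip (8 * kap * k) X1) w.2.1) (fun X2 =>
    psifted kap (clip (6 * k) X2) w.2.2.1))).
  by apply: ks => X /=; apply: card_trim.
apply: keeps_size_bind => [|X1].
  rewrite /ppivot; case: ifP => _; first by move=> c F hF; apply: hF.
  by apply: keeps_size_bind => [|p]; [apply: keeps_size_champion|apply: keeps_size_above].
by apply: keeps_size_bind => [|X2]; apply: keeps_size_sift.
Qed.

Variable T : 'I_n.+1 -> 'I_n.+1 -> bool.

Definition pivoted (w : {ffun 'I_pivot_sample -> 'I_seedN}) : {set 'I_n.+1} :=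
  if (n.+1 <= 8 * kap * k)%N then [set: 'I_n.+1]
  else let l := sample [set: 'I_n.+1] w in above T (champion T (head ord0 l) l).

Definition output (w : seeds) : {set 'I_n.+1} :=
  let X1 := clip (8 * kap * k) (pivoted w.1) in
  let X2 := clip (6 * k) (sifted k T 1 X1 (sample X1 w.2.1)) in
  trim k (sifted k T kap X2 (sample X2 w.2.2.1)) w.2.2.2.

Lemma run_algorithm w : exists2 q,
  (q <= pivot_sample + n.+1 + 8 * kap * k * coarse_sample + 6 * k * fine_sample)%N &
  run T (algorithm w) = (output w, q).
Proof.
have siftP h r X (v : {ffun 'I_r -> 'I_seedN}) :
    computes T (psifted h X v) (sifted k T h X (sample X v)) (#|X| * r).
  have := computes_sift T (sift_test k h r #|X|) (sample X v) X.
  by rewrite /sifted size_sample.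
have [q1 hq1 pivP] : exists2 q1, (q1 <= pivot_sample + n.+1)%N & computes T (ppivot w.1) (pivoted w.1) q1.
  rewrite /ppivot /pivoted; case: ifP => _; first by exists 0; last exact: computes_ret.
  exists (size (sample [set: 'I_n.+1] w.1) + n.+1)%N; first by rewrite size_sample.
  by apply: computes_bind; [apply: computes_champion|apply: computes_above].
set X1 := clip (8 * kap * k) (pivoted w.1).
set X2 := clip (6 * k) (sifted k T 1 X1 (sample X1 w.2.1)).
exists (q1 + (#|X1| * coarse_sample + #|X2| * fine_sample))%N.
  rewrite addnA !leq_add // leq_mul2r card_clip orbT //.
have compP : computes T (pbind (ppivot w.1) (fun X1 =>
    pbind (psifted 1 (clip (8 * kap * k) X1) w.2.1) (fun X2 =>
    psifted kap (clip (6 * k) X2) w.2.2.1)))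
    (sifted k T kap X2 (sample X2 w.2.2.1)) (q1 + (#|X1| * coarse_sample + #|X2| * fine_sample)).
  by apply: computes_bind pivP _; apply: computes_bind (siftP _ _ _ _) _; apply: siftP.
by rewrite /algorithm compP /= addn0.
Qed.

Variables (K : {set 'I_n.+1}) (u : 'I_n.+1).
Hypotheses (k0 : (0 < k)%N) (kap0 : (0 < kap)%N) (lam0 : (0 < lam)%N) (nk : (2 * k + 1 < n.+1)%N).
Hypotheses (vT : valid_instance k T K) (maxu : uncorrupted_max T K u).

(** One group of terms per stage (pivot, coarse sift, fine sift, trimming), chained by [Pr_pair]. *)
Lemma algorithm_fails : Pr [pred w | u \notin output w] <=
  (lam%:R / kap%:R + exp (- lam%:R)%R) + ((8 * kap * k)%N%:R * exp (- (3 * lam)%N%:R)%R +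
    ((6 * k)%N%:R * exp (- (3 * lam)%N%:R)%R + 3%:R / (2 * kap)%N%:R)).
Proof.
have [tT [cK acT]] := vT.
have N0 : (0 < seedN)%N by rewrite fact_gt0.
have XN (X : {set 'I_n.+1}) : (0 < #|X|)%N -> (#|X| %| seedN)%N.
  by move=> X0; rewrite dvdn_fact // X0 /= (leq_trans (max_card _)) // card_ord.
have e0 x : 0 <= exp x by exact/ltW/expr_gt0.
(* Success of the three stages. Under [g1] and [g2] clipping changes nothing; [g3] bounds the excess
   left for trimming. *)
pose g1 (X : {set 'I_n.+1}) := (u \in X) && (#|X| <= 8 * kap * k)%N.
pose g2 (X : {set 'I_n.+1}) := (u \in X) && (1 * #|X| <= 1 * (2 * k + 1) + 3 * k)%N.
pose g3 (X : {set 'I_n.+1}) := (u \in X) && (kap * #|X| <= kap * (2 * k + 1) + 3 * k)%N.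
pose f1 w1 := clip (8 * kap * k) (pivoted w1).
pose f2 X1 (w2 : {ffun 'I_coarse_sample -> 'I_seedN}) := sifted k T 1 X1 (sample X1 w2).
pose f3 X2 (w3 : {ffun 'I_fine_sample -> 'I_seedN}) := sifted k T kap X2 (sample X2 w3).
pose Q4 X3 := [pred i : 'I_seedN | u \notin trim k X3 i].
pose Q3 X2 := [pred v : _ * 'I_seedN | ~~ g3 (f3 X2 v.1) || Q4 (f3 X2 v.1) v.2].
pose Q2 X1 := [pred v : _ * (_ * 'I_seedN) | ~~ g2 (f2 X1 v.1) || Q3 (clip (6 * k) (f2 X1 v.1)) v.2].
apply: le_trans (@PrS _ _ [pred w : seeds | ~~ g1 (pivoted w.1) || Q2 (f1 w.1) w.2] _) _.
  by move=> w /=; rewrite /output => ->; rewrite !orbT.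
have b4 : 0 <= 3%:R / (2 * kap)%N%:R :> R by rewrite divr_ge0.
have b3 : 0 <= (6 * k)%N%:R * exp (- (3 * lam)%N%:R)%R :> R by rewrite mulr_ge0.
have b2 : 0 <= (8 * kap * k)%N%:R * exp (- (3 * lam)%N%:R)%R :> R by rewrite mulr_ge0.
apply: (@Pr_pair _ _ (fun w1 => ~~ g1 (pivoted w1))
  (fun w1 => Q2 (f1 w1))); first by rewrite !addr_ge0.
  rewrite /pivoted; case: (leqP n.+1 (8 * kap * k)) => nM.
    rewrite (_ : Pr _ = 0) ?addr_ge0 // ?divr_ge0 //.
    rewrite /Pr eq_card0 ?mul0r // => w; rewrite unfold_in /=; apply/negbTE.
    by rewrite negbK /g1 in_setT cardsT card_ord nM.
  have tU : (4 * kap * k <= #|~: K|)%N by have := cardsC K; rewrite cK card_ord; nia.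
  apply: le_trans (@PrS _ _ _ _) (le_trans (@above_champion_ok n k seedN T K u N0 XN tT cK acT maxu
     pivot_sample (4 * kap * k)%N tU) _) => [w /=|].
    by apply: contra => /andP[uA cA]; rewrite /g1 uA /=; apply: leq_trans cA _; nia.
  have M0 : (0 < k * kap)%N by rewrite muln_gt0 k0.
  have s1 : (pivot_sample * (k * kap) <= n.+1 * lam)%N by exact: leq_trunc_div.
  have s2 : (n.+1 * lam < (pivot_sample + 1) * (k * kap))%N by rewrite addn1 ltn_ceil.
  (* A positive quotient loses at most a factor 2 by rounding down, which the factor 4 in
     [t = 4 * kap * k] absorbs. *)
  have s3 : (0 < pivot_sample)%N by rewrite divn_gt0 //; nia.
  apply: lerD.
    rewrite ler_pdivrMr ?ltr0n // mulrAC ler_pdivlMr ?ltr0n // -!natrM ler_nat.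
    by rewrite -mulnA mulnC [(lam * _)%N]mulnC; nia.
  apply: ler_exp; rewrite lerN2 ler_pdivlMr ?ltr0n // -natrM ler_nat; nia.
move=> w1; rewrite negbK => /andP[u1 c1].
have f1E : f1 w1 = pivoted w1 by rewrite /f1 /clip c1.
rewrite f1E.
apply: (@Pr_pair _ _ (fun v => ~~ g2 (f2 (pivoted w1) v))
  (fun v => Q3 (clip (6 * k) (f2 (pivoted w1) v)))); first by rewrite !addr_ge0.
  apply: le_trans (@sifted_ok n k seedN T K u N0 XN tT cK maxu (8 * kap)%N 1 lam
     coarse_sample (pivoted w1) k0 isT c1 u1 erefl) _.
  by rewrite ler_wpM2r // ler_nat.
move=> w2; rewrite negbK => /andP[u2]; rewrite !mul1n => c2.
have c2' : (#|f2 (pivoted w1) w2| <= 6 * k)%N by apply: leq_trans c2 _; lia.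
have f2E : clip (6 * k) (f2 (pivoted w1) w2) = f2 (pivoted w1) w2 by rewrite /clip c2'.
rewrite f2E; set X2 := f2 _ _ in u2 c2'.
apply: (@Pr_pair _ _ (fun v => ~~ g3 (f3 X2 v)) (fun v => Q4 (f3 X2 v))) => //.
  apply: le_trans (@sifted_ok n k seedN T K u N0 XN tT cK maxu 6 kap lam
     fine_sample _ k0 kap0 c2' u2 erefl) _.
  by rewrite ler_wpM2r // ler_nat.
move=> w3; rewrite negbK => /andP[u3 c3].
apply: le_trans (@trim_ok n k seedN u N0 XN _ u3) _.
have X0 : (0 < #|f3 X2 w3|)%N by rewrite card_gt0; apply/set0Pn; exists u.
(* Either there is no excess over [2k + 1], or the set has more than [2k] elements and its excess is
   at most [3k / kap]. *)
rewrite ler_pdivrMr ?ltr0n // mulrAC ler_pdivlMr ?ltr0n ?muln_gt0 // -!natrM ler_nat.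
move: c3 X0; set m := #|_|; nia.
Qed.

End Algorithm.

(** * Rounding, constants and the final estimates *)

Local Open Scope R_scope.

(** [up x] lies in [(x, x + 1]], so an integer is rounded to its successor. *)
Definition natceil (x : R) : nat := Z.to_nat (up x).

Lemma natceil_bounds x : 0 <= x -> x <= INR (natceil x) <= x + 1.
Proof.
move=> x0; have [h1 h2] := archimed x.
rewrite INR_IZR_INZ Z2Nat.id; last by apply: le_IZR; Lra.lra.
by split; Lra.lra.
Qed.

Lemma ln_ge1 (k : nat) : (3 <= k)%N -> 1 <= ln (INR k).
Proof.
move=> k3; have kR : 3 <= INR k by have := le_INR 3 k (elimT ssrnat.leP k3); rewrite /=; Lra.lra.
apply: Rnot_lt_le => /exp_increasing; rewrite exp_ln; last by Lra.lra.
by have := exp_le_3; Lra.lra.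
Qed.

Theorem mainTheorem10 (c : R) (hc0 : 0 < c) (hc1 : c <= 1) :
  exists (C1 C2 : R) (k0 : nat) (A : forall n k : nat, randalg n),
    0 < C1 /\ 0 < C2 /\
    forall n k : nat, (k0 <= k)%N -> (2 * k + 1 < n)%N ->
      valid_randalg (2 * k + 1) (A n k) /\
      forall (T : 'I_n -> 'I_n -> bool) (K : {set 'I_n}),
        valid_instance k T K ->
        prob (A n k) T
          (fun r => (exists u, uncorrupted_max T K u /\ u \in r.1) /\
                    INR r.2 <= C2 * (INR n + Rpower (INR k) (1 + 3 * c) * ln (INR k)))
        >= 1 - C1 * Rpower (INR k) (- c) * ln (INR k).
Proof.
pose kapf k := natceil (Rpower (INR k) c); pose lamf k := natceil (ln (INR k)).
(* From [k >= 3] on, [ln k >= 1]. The failure terms add up to [2 + 1 + 16 + 6 + 3/2 <= 27], and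
   [76800 = 9600 * 8], with 8 from [kap <= 2x] (twice) and [lam <= 2L]. For [n = 0] the size
   condition is impossible. *)
exists 27, 76800, 3%N, (fun n => if n is m.+1 then fun k =>
  uniform_randalg (@algorithm m k (kapf k) (lamf k)) else fun=> [::]).
split; first by Lra.lra.
split; first by Lra.lra.
case=> // n k k3 nk.
have kR : 3 <= INR k by have := le_INR 3 k (elimT ssrnat.leP k3); rewrite /=; Lra.lra.
have k0 : (0 < k)%N by apply: leq_trans k3.
set L := ln (INR k); have L1 : 1 <= L by apply: ln_ge1.
have Lk : L + 1 <= INR k.
  by have := exp_ineq1_le L; rewrite /L exp_ln; Lra.lra.
set x := Rpower (INR k) c.
have x1 : 1 <= x.
  by rewrite -(Rpower_O (INR k)); [apply: Rle_Rpower|]; Lra.lra.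
have xk : x <= INR k.
  by rewrite -[X in _ <= X](Rpower_1 (INR k)); [apply: Rle_Rpower|]; Lra.lra.
have [kap1 kap2] : x <= INR (kapf k) <= x + 1 by apply: natceil_bounds; Lra.lra.
have [lam1 lam2] : L <= INR (lamf k) <= L + 1 by apply: natceil_bounds; Lra.lra.
move: (kapf k) (lamf k) kap1 kap2 lam1 lam2 => kap lam kap1 kap2 lam1 lam2.
have kap0 : (0 < kap)%N by apply/ssrnat.ltP; apply: INR_lt => /=; Lra.lra.
have lam0 : (0 < lam)%N by apply/ssrnat.ltP; apply: INR_lt => /=; Lra.lra.
have lamk : (lam <= k)%N by apply/ssrnat.leP; apply: INR_le; Lra.lra.
have N0 : (0 < seedN n)%N by rewrite fact_gt0.
have seeds0 : (0 < #|seeds n k kap lam|)%N.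
  pose z := Ordinal N0; apply/card_gt0P.
  by exists ([ffun=> z], ([ffun=> z], ([ffun=> z], z))).
have nk' := ltnW nk.
split.
  by apply: valid_uniform_randalg => // w; apply: algorithm_leaves.
move=> T K vT; have [tT [cK acT]] := vT.
have [|u uU umax] := exists_max_on tT acT (subxx (~: K)).
  by rewrite -card_gt0; have := cardsC K; rewrite cK card_ord; lia.
have maxu : uncorrupted_max T K u by [].
apply: Rle_ge; apply: Rle_trans; last first.
  apply/RleP; apply: (@prob_uniform_randalg _ _ _ seeds0 T _ [pred w | u \notin output T w]).
  move=> w; rewrite inE negbK => uw; have [q hq ->] := run_algorithm T w.
  split; first by exists u.
  have sn : (pivot_sample n k kap lam <= n.+1)%N.
    rewrite -ltnS ltn_divLR ?muln_gt0 ?k0 //.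
    apply: (@leq_ltn_trans (n.+1 * (k * kap))); last by rewrite ltn_pmul2r ?muln_gt0 ?k0.
    by rewrite leq_mul2l (leq_trans lamk) ?orbT // leq_pmulr.
  (* The two sifts cost [8 * 768 + 6 * 576 = 9600] times [k kap^2 lam]. *)
  have : (q <= 2 * n.+1 + 96 * (100 * (k * (kap * (kap * lam)))))%N.
    apply: leq_trans hq _; rewrite /coarse_sample /fine_sample; nia.
  move/ssrnat.leP/le_INR; rewrite plus_INR !mult_INR [INR 2]/= [INR 96]INR_IZR_INZ [INR 100]INR_IZR_INZ.
  rewrite [Z.of_nat 96]/= [Z.of_nat 100]/= => hR; apply: Rle_trans hR _.
  have -> : Rpower (INR k) (1 + 3 * c) = INR k * (x * (x * x)).
    rewrite Rpower_plus Rpower_1; last by Lra.lra.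
    by rewrite (_ : 3 * c = c + (c + c)); [rewrite !Rpower_plus|Lra.lra].
  have h1 : INR kap * (INR kap * INR lam) <= (2 * x) * ((2 * x) * (2 * L)).
    by repeat apply: Rmult_le_compat; try apply: Rmult_le_pos; try apply: pos_INR; Lra.lra.
  (* The square of [x = k^c] suffices for the algorithm; [x >= 1] raises it to the cube of the
     statement. *)
  have h2 : x * x * L <= x * (x * x) * L.
    apply: Rmult_le_compat_r; first by Lra.lra.
    rewrite -Rmult_assoc -[X in X <= _]Rmult_1_r.
    by apply: Rmult_le_compat_l => //; apply: Rmult_le_pos; Lra.lra.
  have h3 : INR k * (INR kap * (INR kap * INR lam)) <= INR k * (8 * (x * (x * x) * L)).
    by apply: Rmult_le_compat_l; Lra.lra.
  have h4 : 0 <= INR n.+1 by apply: pos_INR.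
  by Lra.lra.
have /RleP := algorithm_fails k0 kap0 lam0 nk vT maxu.
set B := Pr _.
have -> : (lam%:R / kap%:R + exp (- lam%:R) + ((8 * kap * k)%N%:R * exp (- (3 * lam)%N%:R)
    + ((6 * k)%N%:R * exp (- (3 * lam)%N%:R) + 3%:R / (2 * kap)%N%:R)))%R =
  INR lam / INR kap + exp (- INR lam) + (INR (8 * kap * k) * exp (- INR (3 * lam))
    + (INR (6 * k) * exp (- INR (3 * lam)) + INR 3 / INR (2 * kap))).
  by rewrite !INRE.
move=> hB; change (1 - 27 * Rpower (INR k) (- c) * L <= 1 - B).
suff : B <= 27 * Rpower (INR k) (- c) * L by Lra.lra.
apply: Rle_trans hB _; rewrite Rpower_Ropp -/x.
have ix0 : 0 < / x by apply: Rinv_0_lt_compat; Lra.lra.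
have ik0 : 0 < / INR k by apply: Rinv_0_lt_compat; Lra.lra.
have xix : x * / x = 1 by apply: Rinv_r; Lra.lra.
have kik : INR k * / INR k = 1 by apply: Rinv_r; Lra.lra.
have ikx : / INR k <= / x by apply: Rinv_le_contravar; Lra.lra.
have ikapx : / INR kap <= / x by apply: Rinv_le_contravar; Lra.lra.
have e1 : exp (- INR lam) <= / INR k.
  rewrite -[in X in _ <= X](exp_ln (INR k)) -?exp_Ropp; last by Lra.lra.
  have [h|->] : - INR lam < - L \/ - INR lam = - L by Lra.lra.
    exact/Rlt_le/exp_increasing.
  exact: Rle_refl.
(* The factor 3 yields [k^-3], which outweighs the union bounds over [O(k kap)] elements because
   [kap <= 2k]. *)
have e3 : exp (- INR (3 * lam)) <= / INR k * (/ INR k * / INR k).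
  have -> : - INR (3 * lam) = - INR lam + (- INR lam + - INR lam).
    by rewrite mult_INR /=; Lra.lra.
  rewrite !exp_plus; have e0 := exp_pos (- INR lam).
  by repeat apply: Rmult_le_compat; try apply: Rmult_le_pos; Lra.lra.
set e := exp (- INR (3 * lam)) in e3 *.
have t1 : INR lam / INR kap <= 2 * L * / x.
  apply: Rmult_le_compat; [exact: pos_INR| |Lra.lra|by []].
  by apply/Rlt_le/Rinv_0_lt_compat; Lra.lra.
have t2 : INR (8 * kap * k) * e <= 16 * / x.
  rewrite !mult_INR [INR 8]INR_IZR_INZ [Z.of_nat 8]/=.
  have h1 : INR kap * / INR k <= 2.
    apply: (Rmult_le_reg_r (INR k)); first by Lra.lra.
    by rewrite Rmult_assoc [/ _ * _]Rmult_comm kik; Lra.lra.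
  have h2 : 8 * INR kap * INR k * e <=
      8 * INR kap * INR k * (/ INR k * (/ INR k * / INR k)).
    by apply: Rmult_le_compat_l => //; repeat apply: Rmult_le_pos; try apply: pos_INR; Lra.lra.
  have h3 : 8 * INR kap * INR k * (/ INR k * (/ INR k * / INR k)) =
      8 * ((INR kap * / INR k) * / INR k) * (INR k * / INR k) by Lra.lra.
  move: h2; rewrite h3 kik Rmult_1_r => h2; apply: Rle_trans h2 _.
  have : (INR kap * / INR k) * / INR k <= 2 * / INR k by apply: Rmult_le_compat_r; Lra.lra.
  by Lra.lra.
have t3 : INR (6 * k) * e <= 6 * / x.
  rewrite mult_INR [INR 6]INR_IZR_INZ [Z.of_nat 6]/=.
  have h2 : 6 * INR k * e <= 6 * INR k * (/ INR k * (/ INR k * / INR k)).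
    by apply: Rmult_le_compat_l => //; Lra.lra.
  have h3 : 6 * INR k * (/ INR k * (/ INR k * / INR k)) =
      6 * (/ INR k * / INR k) * (INR k * / INR k) by Lra.lra.
  move: h2; rewrite h3 kik Rmult_1_r => h2; apply: Rle_trans h2 _.
  have ik1 : / INR k <= 1 by rewrite -Rinv_1; apply: Rinv_le_contravar; Lra.lra.
  have : / INR k * / INR k <= 1 * / INR k by apply: Rmult_le_compat_r; Lra.lra.
  by Lra.lra.
have t4 : INR 3 / INR (2 * kap) <= 3 / 2 * / x.
  rewrite mult_INR [INR 3]/= [INR 2]/= /Rdiv Rinv_mult.
  by Lra.lra.
have L0 : 1 * / x <= L * / x by apply: Rmult_le_compat_r; Lra.lra.
by Lra.lra.
Qed.
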